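(* For every $n\ge1$, the local $h^\ast$-polynomial $\ell^\ast(\Delta_n^!;z)$ of the factoradic $n$-simplex is real-rooted, and hence unimodal.
   Context: Let $b_{m,k}$ be the number of permutations $\pi\in\mathfrak{S}_m$ whose largest descent position (largest $i$ with $\pi_i>\pi_{i+1}$; $0$ for the identity) equals $k$. The factoradic $n$-simplex is $\Delta_n^!:=\operatorname{conv}\bigl(e^{(1)},\ldots,e^{(n)},-\sum_{k=1}^n b_{n+1,k}e^{(k)}\bigr)\subset\mathbb{R}^n$. For a lattice simplex $\Delta=\operatorname{conv}(v^{(0)},\ldots,v^{(d)})\subset\mathbb{R}^n$, $\ell^\ast(\Delta;z):=\sum_{x\in\Pi^\circ_\Delta\cap\mathbb{Z}^{n+1}}z^{x_{n+1}}$, where $\Pi^\circ_\Delta:=\{\sum_{i=0}^d\lambda_i(v^{(i)},1):0<\lambda_i<1\}$. A polynomial is real-rooted if all its roots are real; it is unimodal if its coefficient sequence weakly increases then weakly decreases. *)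

(* Defs.v *)
From HB Require Import structures.
From mathcomp Require Import all_boot all_order all_algebra all_fingroup all_field.
From Stdlib Require Import ClassicalDescription.
Set Implicit Arguments.
Unset Strict Implicit.
Unset Printing Implicit Defensive.
Import Order.TTheory GRing.Theory Num.Theory.

(* Largest descent position of s in S_m, with 1-indexed positions:
   position p (1 <= p < m) is a descent iff s_p > s_{p+1}.  In 0-indexed
   ordinals this is: j = i+1 and s i > s j, and the position is val j.
   The max over the empty set is 0 (identity permutation). *)
Definition last_descent (m : nat) (s : 'S_m) : nat :=
  \max_(j : 'I_m | [exists i : 'I_m, (val j == (val i).+1) && (s j < s i)%N])
    val j.

Definition bnum (m k : nat) : nat := #|[set s : 'S_m | last_descent s == k]|.

Local Open Scope ring_scope.

(* A lattice simplex in R^n with vertices v 0, ..., v d (v i j = j-th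
   coordinate of the i-th vertex, coordinates 0-indexed).
   (y, h) in Z^n x Z lies in the open parallelepiped Pi°_Delta iff it is
   sum_i lam_i (v i, 1) with 0 < lam_i < 1. *)
Definition in_open_par (n d : nat) (v : 'I_d.+1 -> 'I_n -> int)
    (y : 'I_n -> int) (h : int) : Prop :=
  exists lam : 'I_d.+1 -> rat,
    (forall i, 0 < lam i < 1) /\
    (forall j, (y j)%:~R = \sum_(i < d.+1) lam i * (v i j)%:~R) /\
    h%:~R = \sum_(i < d.+1) lam i.

(* Every point of Pi°_Delta has |y_j| < box_bound v and 0 < h < d+1. *)
Definition box_bound (n d : nat) (v : 'I_d.+1 -> 'I_n -> int) : nat :=
  (\sum_(i < d.+1) \sum_(j < n) `|v i j|)%N.

(* l^*(Delta; z) = sum over lattice points x of Pi°_Delta of z^(x_{n+1}),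
   enumerated over a box that contains Pi°_Delta: y_j = k_j - M with
   0 <= k_j <= 2M, and last coordinate h in [0, d+1]. *)
Definition lstar (n d : nat) (v : 'I_d.+1 -> 'I_n -> int) : {poly int} :=
  let M := box_bound v in
  \sum_(k : {ffun 'I_n -> 'I_(2 * M)%N.+1}) \sum_(h < d.+2)
    (if excluded_middle_informative
          (in_open_par v (fun j => (k j)%:Z - M%:Z) h%:Z)
     then 'X^h else 0).

Definition factoradic_vertex (n : nat) : 'I_n.+1 -> 'I_n -> int :=
  fun i j => if (val i == 0)%N then - (bnum n.+1 (val j).+1)%:Z
             else ((val j).+1 == val i)%:Z.

Arguments factoradic_vertex n : clear implicits.

Definition real_rooted (p : {poly int}) : Prop :=
  forall z : algC, root (map_poly (fun c : int => c%:~R) p) z -> z \is Num.real.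

Definition unimodal (p : {poly int}) : Prop :=
  exists k : nat, (forall i, (i < k)%N -> p`_i <= p`_i.+1) /\
                  (forall i, (k <= i)%N -> p`_i.+1 <= p`_i).

(* Main.v *)
Require Import Defs.
From HB Require Import structures.
From mathcomp Require Import all_boot all_order all_algebra all_fingroup all_field.
From mathcomp Require Import ring zify.
From Stdlib Require Import ClassicalDescription.
Set Implicit Arguments.
Unset Strict Implicit.
Unset Printing Implicit Defensive.
Import Order.TTheory GRing.Theory Num.Theory.

(** The weights satisfy [b_{n+1,k} / (n+1)! = j / (j+1)! = 1/j! - 1/(j+1)!] with
    [j = n+1-k], so the lattice points of the open parallelepiped correspond to
    the integers [0 < b < (n+1)!] such that [(j+1)!] does not divide [b j] for
    [1 <= j <= n].  The sum of the fractional parts of the [b j / (j+1)!]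
    telescopes up to one unit for every ascent of the factoradic digits of [b],
    so the height of the point of [b] is the number of these ascents.  For
    [n >= 2] the condition on [b] only says that [b] is prime to 6.

    Let [E_{n,i}] be the part of the generating polynomial where the top digit
    is [i].  Then [E_{n+1,i} = z sum_{l < i} E_{n,l} + sum_{l >= i} E_{n,l}].  For
    [Im z > 0], the values [a_i = E_{n,i}(z)] satisfy
    [Im (a_j conj(a_i)) >= 0] and [Im (z a_i conj(a_j)) >= 0] for [i <= j]; the
    recursion preserves these inequalities (a pointwise form of interlacing), and
    they keep the [a_i] in a cone of angle less than pi, so that their sum does
    not vanish.  Unimodality follows since multiplication by [X + a], [a >= 0],
    preserves total positivity of order 2 of the coefficients. *)

(** * Permutations by last descent *)

Lemma last_descent_leP (m k : nat) (s : 'S_m) :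
  reflect (forall i j : 'I_m, j = i.+1 :> nat -> k <= i -> s i < s j)
          (last_descent s <= k).
Proof.
apply: (iffP (bigmax_leqP _ _ _)) => [H i j ji ki | H j /existsP[i /andP[/eqP ji lt_s]]].
  rewrite ltnNge; apply/negP => le_s.
  suff: (j <= k) by rewrite ji; lia.
  apply: H.
  apply/existsP; exists i; rewrite /= ji eqxx /= ltn_neqAle le_s andbT.
  apply/eqP => /val_inj/perm_inj ij; move: ji; rewrite ij; lia.
rewrite leqNgt; apply/negP => lt_kj.
by have := H i j ji; move: ji lt_s lt_kj => /= -> ?; lia.
Qed.

Lemma perm_increasing (m : nat) (s : 'S_m) :
  (forall i j : 'I_m, j = i.+1 :> nat -> s i < s j) -> s = 1%g.
Proof.
move=> inc.
have ge_id k : forall i : 'I_m, i = k :> nat -> i <= s i.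
  elim: k => [|k IH] i ik; first by rewrite ik.
  have lt_k : k < m by have := ltn_ord i; lia.
  have := IH (Ordinal lt_k) erefl; have := inc (Ordinal lt_k) i ik => /=; lia.
have le_id k : forall i : 'I_m, i + k = m.-1 -> s i + k <= m.-1.
  elim: k => [|k IH] i ik; first by have := ltn_ord (s i); lia.
  have lt_i : i.+1 < m by lia.
  have := IH (Ordinal lt_i); have := inc i (Ordinal lt_i) erefl => /=; lia.
apply/permP => i; rewrite perm1; apply: val_inj => /=.
have := ge_id i i erefl; have := le_id (m.-1 - i) i; have := ltn_ord i; lia.
Qed.

(** Such a permutation increases beyond position [k], so a free choice of its first [minn k m]
    values determines it. The induction strips the first value. *)
Lemma card_last_descent_le (m k : nat) :
  #|[set s : 'S_m | last_descent s <= k]| = m ^_ (minn k m).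
Proof.
elim: m k => [|m IH] k.
  rewrite minn0 ffactn0 -[RHS](card_Sn 0) cardsE; apply: eq_card => s.
  by rewrite !inE; apply/last_descent_leP => -[].
case: k => [|k].
  rewrite min0n ffactn0 -[RHS](cards1 (1%g : 'S_m.+1)); congr #|pred_of_set _|.
  apply/setP => s; rewrite !inE; apply/last_descent_leP/eqP => [H|-> i j].
    by apply: perm_increasing => i j ij; apply: H.
  by rewrite !perm1 => ->.
rewrite minnSS ffactnS /= -IH.
pose f (u : 'I_m.+1 * 'S_m) : 'S_m.+1 := lift_perm ord0 u.1 u.2.
have f_inj : injective f.
  move=> [i s] [j t] /permP fst.
  have ij : i = j by have := fst ord0; rewrite !lift_perm_id.
  congr pair => //; apply/permP => x.
  by have := fst (lift ord0 x); rewrite !lift_perm_lift /= ij => /lift_inj.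
have -> : [set s : 'S_m.+1 | last_descent s <= k.+1] =
          f @: setX setT [set s : 'S_m | last_descent s <= k].
  have [g _ gK] : bijective f.
    by apply: inj_card_bij => //; rewrite card_prod card_ord !card_Sn.
  apply/setP => s; rewrite -(gK s); move: (g s) => [j t].
  rewrite mem_imset // !inE /=.
  have lift_lt (x y : 'I_m) : (lift j x < lift j y) = (x < y).
    by rewrite /= /bump; lia.
  apply/last_descent_leP/last_descent_leP => H x y.
    move=> xy ki; rewrite -lift_lt -!(lift_perm_lift ord0 j t).
    by apply: H; rewrite !lift0 ?xy.
  case: (unliftP ord0 x) => [x'|] -> //; case: (unliftP ord0 y) => [y'|] ->; last by [].
  rewrite !lift0 => -[xy] ki; rewrite !lift_perm_lift lift_lt; exact: H.
by rewrite card_imset // cardsX cardsT card_ord.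
Qed.

Lemma bnum_ffact (m k : nat) : k < m -> bnum m k.+1 + m ^_ k = m ^_ k.+1.
Proof.
move=> lt_km; have := card_last_descent_le m k.+1.
rewrite (minn_idPl lt_km) => <-; have := card_last_descent_le m k.
rewrite (minn_idPl (ltnW lt_km)) => <-; rewrite /bnum.
rewrite -[RHS](cardsID [set s : 'S_m | last_descent s == k.+1]).
congr (_ + _); congr #|pred_of_set _|; apply/setP => s; rewrite !inE; lia.
Qed.

(* With [j = n - k], the weight [bnum n.+1 k.+1] is the fraction
   [j / (j + 1)! = 1 / j! - 1 / (j + 1)!] of the total [(n + 1)!]. *)
Lemma bnum_fact (n k : nat) :
  k < n -> bnum n.+1 k.+1 * (n - k).+1`! = (n - k) * n.+1`!.
Proof.
move=> lt_kn; have lt_kn1 : k < n.+1 by lia.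
have := bnum_ffact lt_kn1.
have := ffact_fact (ltnW lt_kn1); have := ffact_fact lt_kn1.
rewrite subSS (_ : n.+1 - k = (n - k).+1); last lia.
rewrite [(n - k).+1`!]factS; move: (n.+1)`! (n - k)`! (_ ^_ k.+1) (_ ^_ k) (bnum _ _).
move: (n - k) => d F f a b c aF bF ca.
have : (c + b) * (d.+1 * f) = d.+1 * F by rewrite ca -aF mulnCA.
by rewrite mulnDl bF mulSn addnC => /addnI.
Qed.

(** * Factoradic digits *)

(** Digit of weight j! in the factorial number system. Digit 0 is always 0, so a nonzero digit 1
    counts as an ascent. *)
Definition digit (b j : nat) : nat := (b %/ j`!) %% j.+1.

Definition digit_asc (n b : nat) : nat :=
  \sum_(j < n) (digit b j < digit b j.+1).

Lemma digit_ltE b j :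
  (digit b j < digit b j.+1) = (b %% j.+1`! * j.+1 < j.+1`! * digit b j.+1).
Proof.
have -> : digit b j = (b %% j.+1`!) %/ j`!.
  by rewrite /digit modn_divl factS.
set r := b %% _; rewrite factS; have f0 := fact_gt0 j.
rewrite [X in _ = (X < _)]mulnC -mulnA ltn_pmul2l //.
by rewrite ltn_divLR // [digit _ _ * _]mulnC.
Qed.

(* [j / (j + 1)! = 1 / j! - 1 / (j + 1)!], and the integral parts differ from
   this relation exactly at the ascents of the digit sequence. *)
Lemma floor_digit_asc b j :
  (b * j.+1) %/ j.+2`! + b %/ j.+2`! + (digit b j < digit b j.+1) = b %/ j.+1`!.
Proof.
rewrite digit_ltE /digit [j.+2`!]factS; set D := j.+1`!.
have D0 : 0 < D by exact: fact_gt0.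
clearbody D; have DJ0 : 0 < D * j.+2 by rewrite muln_gt0 D0.
have rD : b %% D < D by rewrite ltn_mod.
rewrite [j.+2 * D]mulnC [b %/ (_ * _)]divnMA {1}(divn_eq b D).
move: (b %/ D) (b %% D) rD => B r rD.
have cj : B %% j.+2 < j.+2 by rewrite ltn_mod.
rewrite {1}(divn_eq B j.+2) [RHS](divn_eq B j.+2).
move: (B %/ j.+2) (B %% j.+2) cj => e c cj.
have -> : ((e * j.+2 + c) * D + r) * j.+1
          = (e * j.+1) * (D * j.+2) + (r * j.+1 + D * c * j.+1) by ring.
rewrite divnMDl //.
(* Here [c] is the digit at [j.+1]. The numerator is [c * (D * j.+2)] plus [r * j.+1 - D * c], which
   is smaller than [D * j.+2] in absolute value; its sign decides between [c] and [c - 1]. *)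
suff -> : (r * j.+1 + D * c * j.+1) %/ (D * j.+2) = c - (r * j.+1 < D * c).
  have : (r * j.+1 < D * c) <= c.
    by case: c cj => [|c] _; rewrite ?muln0 // (leq_trans (leq_b1 _)).
  lia.
case: ltnP => lt_r.
  case: c cj lt_r => [|c] cj lt_r; first by rewrite muln0 in lt_r.
  rewrite subn1 /=.
  have -> : r * j.+1 + D * c.+1 * j.+1 = c * (D * j.+2) + (r * j.+1 + D * (j.+1 - c)).
    have [x ->] : exists x, j.+1 = c + x by exists (j.+1 - c); lia.
    by rewrite addKn; ring.
  rewrite divnMDl // divn_small ?addn0 //.
  nia.
rewrite /= subn0.
have -> : r * j.+1 + D * c * j.+1 = c * (D * j.+2) + (r * j.+1 - D * c).
  by nia.
rewrite divnMDl // divn_small ?addn0 //.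
nia.
Qed.

(** The relations [floor_digit_asc] telescope from [b] down to the quotient of [b] by (n+1)!, which
    is 0. *)
Lemma sum_floor_asc n b : b < n.+1`! ->
  \sum_(j < n) (b * j.+1) %/ j.+2`! + digit_asc n b = b.
Proof.
move=> lt_b; rewrite -[RHS](divn1 b) -[1]/(1`!).
suff <- : \sum_(j < n) (b * j.+1) %/ j.+2`! + digit_asc n b + b %/ n.+1`! = b %/ 1`!.
  by rewrite divn_small ?addn0.
rewrite /digit_asc; elim: n {lt_b} => [|n IH]; first by rewrite !big_ord0.
by rewrite !big_ord_recr /= -IH -(floor_digit_asc b n); ring.
Qed.

Lemma digit_asc_le n b : digit_asc n b <= n.
Proof.
rewrite -[leqRHS]muln1 -[X in X * 1]card_ord -sum_nat_const /digit_asc.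
by apply: leq_sum => j _; case: (_ < _).
Qed.

Lemma digit_fact_addl n i x j : j <= n -> digit (i * n.+1`! + x) j = digit x j.
Proof.
move=> le_jn.
have /dvdnP[u ->] : j.+1`! %| n.+1`!.
  have <- := @ffact_fact n.+1 (n - j) (leqW (leq_subr _ _)).
  by rewrite subSn ?leq_subr // subKn // dvdn_mull.
rewrite /digit factS !mulnA divnMDl ?fact_gt0 //.
by rewrite modnMDl.
Qed.

Lemma digit_top n i x : i <= n -> x < n`! -> digit (i * n`! + x) n = i.
Proof.
by move=> le_in lt_x; rewrite /digit divnMDl ?fact_gt0 // divn_small // addn0 modn_small.
Qed.

Lemma digit_asc_recr n i l x : i <= n.+1 -> l <= n -> x < n`! ->
  digit_asc n.+1 (i * n.+1`! + (l * n`! + x))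
  = (l < i) + digit_asc n (l * n`! + x).
Proof.
move=> le_i le_l lt_x; rewrite /digit_asc big_ord_recr /= addnC; congr (_ + _).
  rewrite digit_fact_addl // digit_top // digit_top //.
  by rewrite factS; nia.
by apply: eq_bigr => j _; rewrite !digit_fact_addl // ltnW.
Qed.

Lemma sum_nat_mul (R : nmodType) k m (F : nat -> R) :
  (\sum_(0 <= b < k * m) F b = \sum_(i < k) \sum_(0 <= b < m) F (i * m + b)%N)%R.
Proof.
elim: k => [|k IH]; first by rewrite big_ord0 big_geq.
rewrite big_ord_recr /= -IH (@big_cat_nat _ _ _ (k * m)%N) //=; last by lia.
congr (_ + _)%R; rewrite -{1}[(k * m)%N]add0n big_addn.
by rewrite mulSn addnK; apply: eq_bigr => i _; rewrite addnC.
Qed.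

(* Selects the [b] for which every barycentric coordinate [frac (b * j / (j + 1)!)],
   [1 <= j <= n], is nonzero. *)
Definition interior_index (n b : nat) : bool :=
  [forall j : 'I_n, ~~ (j.+2`! %| b * j.+1)].

Definition coprime6 (b : nat) : bool := odd b && ~~ (3 %| b).

(** The first two conditions say that 2 and 3 do not divide [b]. The later ones follow from [b] odd:
    after cancelling [j.+1], the divisor still contains an even factorial. *)
Lemma interior_indexE n b : 1 < n -> interior_index n b = coprime6 b.
Proof.
move=> n1; apply/forallP/andP => [H|[b2 b3] [[|[|j]] lt_j]] /=.
- have := H (Ordinal (ltnW n1)); have := H (Ordinal n1) => /=.
  rewrite -[3`!]/(3 * 2) -[2`!]/2 dvdn_pmul2r // => ->; rewrite muln1 dvdn2 negbK.
  by [].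
- by rewrite muln1 dvdn2 b2.
- by rewrite -[3`!]/(3 * 2) dvdn_pmul2r.
apply/negP; rewrite [j.+4`!]factS [j.+3`!]factS mulnCA [b * _]mulnC dvdn_pmul2l // => dv.
suff: 2 %| b by rewrite dvdn2 b2.
by apply: dvdn_trans dv; rewrite dvdn_mull // (@dvdn_fact 2).
Qed.

Local Open Scope ring_scope.

(** * Interlacing in the upper half-plane *)

(** The determinant of [(v, u)] as plane vectors: nonnegative when [u] lies counterclockwise from
    [v] by an angle of at most pi. *)
Definition cross (u v : algC) : algC := 'Im (u * v^*).

(** A form polynomial in [u], [v] and their conjugates, on which [ring] can work. *)
Lemma crossE u v : cross u v = 'i / 2 * (v * u^* - u * v^*).
Proof. rewrite /cross ImE rmorphM /= conjCK; ring. Qed.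

Lemma crossMM z u v : cross (z * u) (z * v) = `|z| ^+ 2 * cross u v.
Proof. rewrite !crossE normCK !rmorphM /=; ring. Qed.

Lemma crossMid z u : cross (z * u) u = 'Im z * `|u| ^+ 2.
Proof. rewrite !crossE normCK ImE !rmorphM /=; ring. Qed.

Lemma cross_sum_ge0 (I : finType) (P Q : pred I) (f g : I -> algC) :
  (forall i j, P i -> Q j -> 0 <= cross (f i) (g j)) ->
  0 <= cross (\sum_(i | P i) f i) (\sum_(j | Q j) g j).
Proof.
move=> H; rewrite /cross mulr_suml raddf_sum; apply: sumr_ge0 => i Pi.
rewrite rmorph_sum mulr_sumr raddf_sum; apply: sumr_ge0 => j Qj; exact: H.
Qed.

Definition asc_step (z : algC) (m : nat) (a : nat -> algC) (i : nat) : algC :=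
  \sum_(l < m) (if (l < i)%N then z else 1) * a l.

(** For [z] in the upper half-plane and nonzero values, [a j] lies in the cone from [a i]
    counterclockwise to [z * a i]. The weak inequalities admit zero values, such as
    [layer z 2 1]. *)
Definition cross_ordered (z : algC) (m : nat) (a : nat -> algC) : Prop :=
  forall i j, (i <= j < m)%N ->
    0 <= cross (a j) (a i) /\ 0 <= cross (z * a i) (a j).

(** Cutting the sum at [i] and [j] into [A], [S], [C], the two new values differ only by the factor
    [z] on [S]. The bilinear expansion leaves only nonnegative terms. *)
Lemma asc_step_ordered z m a :
  0 < 'Im z -> cross_ordered z m a -> cross_ordered z m.+1 (asc_step z m a).
Proof.
move=> z_gt0 ord_a i j /andP[le_ij lt_jm].
pose A : algC := \sum_(l < m | (l < i)%N) a l.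
pose S : algC := \sum_(l < m | (i <= l < j)%N) a l.
pose C : algC := \sum_(l < m | (j <= l)%N) a l.
have Ei : asc_step z m a i = z * A + S + C.
  rewrite /asc_step (bigID (fun l : 'I_m => (l < i)%N)) /=.
  rewrite mulr_sumr -addrA; congr (_ + _); first by apply: eq_bigr => l ->.
  rewrite (bigID (fun l : 'I_m => (l < j)%N)) /=.
  congr (_ + _); apply: eq_big => l; try lia.
    by move=> /andP[/negbTE-> _]; rewrite mul1r.
  by move=> /andP[/negbTE-> _]; rewrite mul1r.
have Ej : asc_step z m a j = z * A + z * S + C.
  rewrite /asc_step (bigID (fun l : 'I_m => (l < j)%N)) /=; congr (_ + _); last first.
    apply: eq_big => l; try lia.
    by move=> /negbTE->; rewrite mul1r.
  rewrite (bigID (fun l : 'I_m => (l < i)%N)) /= !mulr_sumr.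
  congr (_ + _); apply: eq_big => l; try lia.
    by move=> /andP[-> _].
  by move=> /andP[-> _].
have SA : 0 <= cross S A.
  by apply: cross_sum_ge0 => k l ? ?; apply ord_a; have := ltn_ord k; lia.
have CS : 0 <= cross C S.
  by apply: cross_sum_ge0 => k l ? ?; apply ord_a; have := ltn_ord k; lia.
have zAS : 0 <= cross (z * A) S.
  rewrite /A mulr_sumr.
  by apply: cross_sum_ge0 => k l ? ?; apply ord_a; have := ltn_ord l; lia.
have zSC : 0 <= cross (z * S) C.
  rewrite /S mulr_sumr.
  by apply: cross_sum_ge0 => k l ? ?; apply ord_a; have := ltn_ord l; lia.
have sq_ge0 (u : algC) : 0 <= `|u| ^+ 2 by rewrite exprn_ge0.
have zz u : 0 <= cross (z * u) u by rewrite crossMid mulr_ge0 // ltW.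
rewrite Ei Ej; split.
  (* The products of [z * A] with [C] cancel by antisymmetry. *)
  suff -> : cross (z * A + z * S + C) (z * A + S + C) =
      cross (z * A) S + `|z| ^+ 2 * cross S A + cross (z * S) S
      + cross (z * S) C + cross C S.
    by rewrite !addr_ge0 // mulr_ge0.
  by rewrite -crossMM !crossE !rmorphD !rmorphM /=; ring.
(* The terms free of [S] combine to [cross (z * u) u] with [u = z * A + C]. *)
suff -> : cross (z * (z * A + S + C)) (z * A + z * S + C) =
    cross (z * (z * A + C)) (z * A + C) + `|z| ^+ 2 * cross (z * A) S
    + `|z| ^+ 2 * cross S A + cross (z * S) C + `|z| ^+ 2 * cross C S.
  by rewrite !addr_ge0 // mulr_ge0.
by rewrite -!crossMM !crossE !rmorphD !rmorphM /= ?rmorphD ?rmorphM; ring.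
Qed.

(* All [a l] lie in the cone spanned by [a 0] and [z * a 0], whose angle is
   less than pi. *)
Lemma cross_ordered_sum_neq0 z m a :
  0 < 'Im z -> a 0 != 0 -> cross_ordered z m.+1 a -> \sum_(l < m.+1) a l != 0.
Proof.
move=> z_gt0 a0 ord_a; apply/eqP => sum0.
have: 0 < cross (z * a 0) (\sum_(l < m.+1) a l).
  rewrite /cross rmorph_sum mulr_sumr raddf_sum big_ord_recl /=.
  rewrite ltr_pwDl //.
    by rewrite -/(cross _ _) crossMid mulr_gt0 // exprn_gt0 // normr_gt0.
  by apply: sumr_ge0 => l _; apply ord_a; have := ltn_ord l; rewrite /bump; lia.
by rewrite sum0 /cross rmorph0 mulr0 raddf0 ltxx.
Qed.

Lemma asc_step0_neq0 z m a :
  0 < 'Im z -> a 0 != 0 -> cross_ordered z m.+1 a -> asc_step z m.+1 a 0 != 0.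
Proof.
move=> z_gt0 a0 ord_a; rewrite /asc_step.
under eq_bigr => l _ do rewrite ltn0 mul1r.
exact: cross_ordered_sum_neq0 ord_a.
Qed.

(** * Unimodality of real-rooted polynomials *)

(* Total positivity of order 2 of the coefficient sequence: log-concavity
   without internal zeros. *)
Definition tp2 (R : numDomainType) (p : {poly R}) : Prop :=
  (forall i, 0 <= p`_i) /\
  (forall i j, (i <= j)%N -> p`_i * p`_j.+2 <= p`_i.+1 * p`_j.+1).

(** Each new minor is a polynomial in [a] whose coefficients are minors or products of the old
    coefficients, all nonnegative. *)
Lemma tp2_mulXaddC (R : numDomainType) (p : {poly R}) (a : R) :
  0 <= a -> tp2 p -> tp2 (p * ('X + a%:P)).
Proof.
move=> a0 [p0 pT].
have E0 : (p * ('X + a%:P))`_0 = a * p`_0.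
  by rewrite mulrDr coefD coefMX coefMC /= add0r mulrC.
have ES i : (p * ('X + a%:P))`_i.+1 = p`_i + a * p`_i.+1.
  by rewrite mulrDr coefD coefMX coefMC /= [_ * a]mulrC.
split=> [[|i]|[|i] [|j] // le_ij].
- by rewrite E0 mulr_ge0.
- by rewrite ES addr_ge0 // mulr_ge0.
- rewrite E0 !ES -subr_ge0.
  have -> : (p`_0 + a * p`_1) * (p`_0 + a * p`_1) - a * p`_0 * (p`_1 + a * p`_2)
   = p`_0 * p`_0 + a * (p`_0 * p`_1) + a * a * (p`_1 * p`_1 - p`_0 * p`_2) by ring.
  by rewrite !addr_ge0 // !mulr_ge0 // subr_ge0 pT.
- rewrite E0 !ES -subr_ge0.
  have -> : (p`_0 + a * p`_1) * (p`_j.+1 + a * p`_j.+2)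
              - a * p`_0 * (p`_j.+2 + a * p`_j.+3)
   = p`_0 * p`_j.+1 + a * (p`_1 * p`_j.+1)
     + a * a * (p`_1 * p`_j.+2 - p`_0 * p`_j.+3) by ring.
  by rewrite !addr_ge0 // !mulr_ge0 // subr_ge0 pT.
(* This minor is the coefficient of [a]. Two instances of [pT] are chained through the product of
   the coefficients [i.+1] and [j.+2]. *)
have T2 : p`_i * p`_j.+3 <= p`_i.+2 * p`_j.+1.
  apply: le_trans (pT i j.+1 _) _; first by lia.
  by case: (ltngtP i j) => [lt_ij|lt_ji|->]; [exact: pT|lia|rewrite mulrC].
rewrite !ES -subr_ge0.
have -> : (p`_i.+1 + a * p`_i.+2) * (p`_j.+1 + a * p`_j.+2)
            - (p`_i + a * p`_i.+1) * (p`_j.+2 + a * p`_j.+3)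
 = (p`_i.+1 * p`_j.+1 - p`_i * p`_j.+2)
   + a * (p`_i.+2 * p`_j.+1 - p`_i * p`_j.+3)
   + a * a * (p`_i.+2 * p`_j.+2 - p`_i.+1 * p`_j.+3) by ring.
have d0 : 0 <= p`_i.+1 * p`_j.+1 - p`_i * p`_j.+2 by rewrite subr_ge0 pT.
have d1 : 0 <= p`_i.+2 * p`_j.+1 - p`_i * p`_j.+3 by rewrite subr_ge0.
have d2 : 0 <= p`_i.+2 * p`_j.+2 - p`_i.+1 * p`_j.+3 by rewrite subr_ge0 pT.
exact: addr_ge0 (addr_ge0 d0 (mulr_ge0 a0 d1)) (mulr_ge0 (mulr_ge0 a0 a0) d2).
Qed.

Lemma tp2_prod_roots (rs : seq algC) :
  all (fun r => r <= 0) rs -> tp2 (\prod_(r <- rs) ('X - r%:P)).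
Proof.
elim: rs => [_|r rs IH /= /andP[r0 /IH rs0]].
  rewrite big_nil; split=> [i|i j _]; first by rewrite coef1 ler0n.
  by rewrite !coef1 mulr0 mul0r.
by rewrite big_cons mulrC -polyCN; apply: tp2_mulXaddC; rewrite ?oppr_ge0.
Qed.

(** Nonnegative coefficients force the real roots to be [<= 0], so the factorization makes the
    coefficients totally positive of order 2; this forbids a rise after the first strict descent. *)
Lemma unimodal_of_real_rooted (p : {poly int}) :
  (forall i, 0 <= p`_i) -> p != 0 -> real_rooted p -> unimodal p.
Proof.
move=> p_ge0 p_neq0 p_real.
pose f : int -> algC := intr.
pose q := map_poly f p.
have qE i : q`_i = (p`_i)%:~R by rewrite coef_map_id0.
have q_neq0 : q != 0.
  apply: contra p_neq0 => /eqP q0; apply/eqP/polyP => i.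
  by apply/eqP; rewrite coef0 -(intr_eq0 algC) -qE q0 coef0.
have lead_gt0 : 0 < lead_coef q.
  by rewrite lt_def lead_coef_eq0 q_neq0 lead_coefE qE ler0z p_ge0.
have [rs q_rs] := closed_field_poly_normal q.
have rs_le0 : all (fun r => r <= 0) rs.
  apply/allP => r r_rs.
  have rt : root q r by rewrite q_rs rootZ ?gt_eqF // root_prod_XsubC.
  have r_real := p_real r rt.
  rewrite real_leNgt ?real0 //; apply/negP => r_gt0.
  move: rt; rewrite rootE horner_coef => /eqP.
  have sz_gt0 : (0 < size q)%N by rewrite size_poly_gt0.
  (* At a positive root the leading term would be positive and the others nonnegative. *)
  rewrite (bigD1 (Ordinal (ltac:(by rewrite prednK) : ((size q).-1 < size q)%N))) //=.
  move/eqP; rewrite gt_eqF // ltr_pwDl //.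
    by rewrite mulr_gt0 // ?exprn_gt0 // -lead_coefE.
  by apply: sumr_ge0 => i _; rewrite qE mulr_ge0 ?ler0z // exprn_ge0 // ltW.
have pT i j : (i <= j)%N -> p`_i * p`_j.+2 <= p`_i.+1 * p`_j.+1.
  move=> le_ij; rewrite -(ler_int algC) !rmorphM /= -!qE q_rs !coefZ.
  rewrite mulrACA [leRHS]mulrACA ler_wpM2l //.
    by rewrite mulr_ge0 // ltW.
  by have [_ T] := tp2_prod_roots rs_le0; exact: T.
have desc : exists i, p`_i.+1 < p`_i.
  exists (size p).-1; rewrite prednK ?size_poly_gt0 // nth_default //.
  by rewrite lt_def -lead_coefE lead_coef_eq0 p_neq0 lead_coefE p_ge0.
case: (ex_minnP desc) => k desc_k min_k; exists k; split=> i.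
  by move=> lt_ik; rewrite leNgt; apply/negP => /min_k; lia.
rewrite leq_eqVlt => /predU1P[<-|lt_ki]; first exact: ltW.
case: i lt_ki => // i le_ki; rewrite leNgt; apply/negP => lt_i.
(* The descent at [k] and a rise at [i.+1] together reverse this inequality strictly. *)
have := pT k i le_ki; apply/negP; rewrite -ltNge.
apply: (@le_lt_trans _ _ (p`_k.+1 * p`_i.+2)).
  by rewrite ler_wpM2l // ltW.
by rewrite ltr_pM2r // (le_lt_trans (p_ge0 i.+1)).
Qed.

(** * The ascent polynomial *)

(** The value at [z] of E_{n,i}: [b] runs over the lower digits, and [coprime6] agrees with
    [interior_index n] once [1 < n]. *)
Definition layer (z : algC) (n i : nat) : algC :=
  \sum_(0 <= b < n`! | coprime6 (i * n`! + b)) z ^+ digit_asc n (i * n`! + b).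

Lemma coprime6_fact_addl n i x :
  (1 < n)%N -> coprime6 (i * n.+1`! + x) = coprime6 x.
Proof.
move=> n1.
have dv k : (0 < k <= 3)%N -> (k %| i * n.+1`!)%N.
  by move=> k3; rewrite dvdn_mull // dvdn_fact //; lia.
rewrite /coprime6 dvdn_addr ?dv //; congr (_ && _).
by rewrite oddD -[odd (i * _)]negbK -dvdn2 dv.
Qed.

Lemma layer_recr z n i :
  (1 < n)%N -> (i <= n.+1)%N ->
  layer z n.+1 i = asc_step z n.+1 (layer z n) i.
Proof.
move=> n1 le_i; rewrite /layer big_mkcond /=.
pose F b := if coprime6 (i * n.+1`! + b)
            then z ^+ digit_asc n.+1 (i * n.+1`! + b) else 0.
rewrite -/F -[LHS]/(\sum_(0 <= b < n.+1 * n`!) F b) sum_nat_mul.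
apply: eq_bigr => l _; rewrite mulr_sumr [RHS]big_mkcond /=.
apply: eq_big_nat => b /andP[_ lt_b].
rewrite /F coprime6_fact_addl //; case: ifP => // _.
have lt_l := ltn_ord l.
rewrite digit_asc_recr // exprD; congr (_ * _).
by case: ltnP; rewrite ?expr1 ?expr0.
Qed.

(** Below 6 only 1 and 5 are prime to 6; from index 0 on, their digits are 0, 1, 0 and 0, 1, 2. *)
Lemma layer2 z : [/\ layer z 2 0 = z, layer z 2 1 = 0 & layer z 2 2 = z ^+ 2].
Proof.
rewrite /layer; split; rewrite big_mkcond /= -[2`!]/2%N !big_nat_recr //= big_geq //.
- by rewrite !add0r /digit_asc !big_ord_recr big_ord0.
- by rewrite !addr0.
by rewrite !add0r /digit_asc !big_ord_recr big_ord0.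
Qed.

(** The cone argument needs a nonzero bottom layer; it persists because the next bottom layer is the
    sum of all current layers. *)
Lemma layers_ordered z n : 0 < 'Im z -> (1 < n)%N ->
  layer z n 0 != 0 /\ cross_ordered z n.+1 (layer z n).
Proof.
move=> z_gt0; case: n => [|[|n]] // _.
have z_neq0 : z != 0 by apply: contraTneq z_gt0 => ->; rewrite raddf0 ltxx.
elim: n => [|n [neq0 ord_n]].
  have [L0 L1 L2] := layer2 z; rewrite L0; split=> //.
  have zz u : 0 <= cross (z * u) u.
    by rewrite crossMid mulr_ge0 ?exprn_ge0 // ltW.
  have c0l u : cross 0 u = 0 by rewrite /cross mul0r raddf0.
  have c0r u : cross u 0 = 0 by rewrite /cross rmorph0 mulr0 raddf0.
  have cc u : cross u u = 0 by rewrite crossE; ring.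
  by move=> [|[|[|i]]] [|[|[|j]]] /andP[] // _ _;
    split; rewrite ?L0 ?L1 ?L2 ?expr2 ?mulr0 ?c0l ?c0r ?cc.
split.
  by rewrite layer_recr //; exact: asc_step0_neq0.
move=> i j le_ij; rewrite !layer_recr //; try lia.
exact: (asc_step_ordered z_gt0 ord_n).
Qed.

Definition ascent_poly (n : nat) : {poly int} :=
  \sum_(0 <= b < n.+1`! | interior_index n b) 'X^(digit_asc n b).

Lemma ascent_poly_eval n (z : algC) :
  (map_poly (intr : int -> algC) (ascent_poly n)).[z] =
  \sum_(0 <= b < n.+1`! | interior_index n b) z ^+ digit_asc n b.
Proof.
rewrite /ascent_poly rmorph_sum horner_sum; apply: eq_bigr => b _.
by rewrite rmorphXn /= map_polyX hornerXn.
Qed.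

Lemma ascent_poly_neq0 n (z : algC) : (0 < n)%N -> 0 < 'Im z ->
  (map_poly (intr : int -> algC) (ascent_poly n)).[z] != 0.
Proof.
move=> n_gt0 z_gt0; rewrite ascent_poly_eval.
have z_neq0 : z != 0 by apply: contraTneq z_gt0 => ->; rewrite raddf0 ltxx.
case: n n_gt0 => [|[|n]] // _.
  (* For [n = 1] the only index is 1, with one ascent, so the value is [z]. *)
  rewrite big_mkcond -[2`!]/2%N !big_nat_recr //= big_geq //.
  have -> : interior_index 1 0 = false.
    by apply/negbTE/forallPn; exists ord0.
  have -> : interior_index 1 1 = true.
    by apply/forallP => -[[|j] lt_j].
  by rewrite !add0r /digit_asc !big_ord_recr big_ord0.
have -> : \sum_(0 <= b < n.+3`! | interior_index n.+2 b) z ^+ digit_asc n.+2 b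
       = \sum_(i < n.+3) layer z n.+2 i.
  pose F b := if coprime6 b then z ^+ digit_asc n.+2 b else 0.
  under [RHS]eq_bigr do rewrite /layer big_mkcond /=.
  rewrite -(sum_nat_mul _ _ F) big_mkcond -[(n.+3 * _)%N]/(n.+3`!).
  by apply: eq_bigr => b _; rewrite interior_indexE.
have [neq0 ord_n] := layers_ordered z_gt0 (isT : (1 < n.+2)%N).
exact: cross_ordered_sum_neq0 ord_n.
Qed.

Lemma ascent_poly_real_rooted n : (0 < n)%N -> real_rooted (ascent_poly n).
Proof.
move=> n_gt0 z rz.
have {}rz : (map_poly (intr : int -> algC) (ascent_poly n)).[z] = 0.
  exact/eqP.
have [||lt0|gt0|/Creal_ImP//] := @real_ltgtP _ ('Im z) 0.
- exact: Creal_Im.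
- exact: real0.
(* The coefficients are integers, so conjugation moves a root to the upper half-plane. *)
- have : 0 < 'Im (z^*) by rewrite Im_conj oppr_gt0.
  move=> /(ascent_poly_neq0 n_gt0); rewrite ascent_poly_eval => /eqP[].
  apply: (can_inj conjCK); rewrite rmorph0 -[RHS]rz ascent_poly_eval rmorph_sum.
  by apply: eq_bigr => b _; rewrite rmorphXn /= conjCK.
- by have := ascent_poly_neq0 n_gt0 gt0; rewrite rz eqxx.
Qed.

Lemma ascent_poly_unimodal n : (0 < n)%N -> unimodal (ascent_poly n).
Proof.
move=> n_gt0; apply: unimodal_of_real_rooted; last exact: ascent_poly_real_rooted.
  move=> i; rewrite /ascent_poly coef_sum sumr_ge0 // => b _.
  by rewrite coefXn ler0n.
apply/eqP => p0; have := @ascent_poly_neq0 n 'i n_gt0.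
by rewrite p0 rmorph0 horner0 eqxx Im_i ltr01 => /(_ isT).
Qed.

(** * Lattice points of the open parallelepiped *)

Lemma sum_bnum m k : (k <= m)%N -> (\sum_(i < k) bnum m i.+1 + 1 = m ^_ k)%N.
Proof.
elim: k => [|k IH] le_k; first by rewrite big_ord0.
by rewrite big_ord_recr /= -bnum_ffact // -IH ?(ltnW le_k) // addnAC addnC.
Qed.

(** Up to sign, the coordinate [j] of the lattice point attached to [b]. *)
Definition facet_floor (n b : nat) (j : 'I_n) : nat :=
  (b * (n - j)) %/ (n - j).+1`!.

Lemma sum_facet_floor n b : (b < n.+1`!)%N ->
  (\sum_(j < n) facet_floor b j + digit_asc n b = b)%N.
Proof.
move=> lt_b; rewrite -[RHS](sum_floor_asc lt_b); congr (_ + _)%N.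
rewrite (reindex_inj rev_ord_inj) /=; apply: eq_bigr => j _; rewrite /facet_floor /=.
by have -> : (n - (n - j.+1) = j.+1)%N by have := ltn_ord j; lia.
Qed.

Lemma interior_index_rev n b : interior_index n b ->
  forall j : 'I_n, ~~ ((n - j).+1`! %| b * (n - j))%N.
Proof.
move=> /forallP int_b j; have := int_b (rev_ord j) => /=.
by have -> : ((n - j.+1).+1 = n - j)%N by have := ltn_ord j; lia.
Qed.

(** With denominators cleared, the hypothesis puts [y + t / d] strictly between 0 and 1. *)
Lemma floor_unique (y : int) (t d : nat) : 0 < y * d%:Z + t%:Z < d%:Z ->
  y = - (t %/ d)%N%:Z /\ ~~ (d %| t)%N.
Proof.
move=> H; have d0 : (0 < d)%N by lia.
have t_eq := divn_eq t d; have lt_r : (t %% d < d)%N by rewrite ltn_mod.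
rewrite /dvdn; move: (t %/ d)%N (t %% d)%N t_eq lt_r => q r t_eq lt_r.
have E : y * d%:Z + t%:Z = (y + q%:Z) * d%:Z + r%:Z by rewrite t_eq; lia.
rewrite E in H.
have yq : y + q%:Z = 0 by nia.
by split; [lia | rewrite yq in H; lia].
Qed.

Lemma intr_scaled_frac (y : int) (b r d : nat) : (0 < d)%N ->
  (y * d%:Z + (b * r)%N%:Z)%:~R =
  (y%:~R + b%:R * (r%:R / d%:R)) * d%:R :> rat.
Proof.
move=> d0; rewrite PoszM intrD !intrM -!pmulrn mulrDl -!mulrA mulVf ?mulr1 //.
by rewrite pnatr_eq0 -lt0n.
Qed.

Lemma floor_bounds (t d : nat) : (0 < d)%N -> ~~ (d %| t)%N ->
  0 < - (t %/ d)%N%:Z * d%:Z + t%:Z < d%:Z.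
Proof.
move=> d0; rewrite /dvdn => r0; have := divn_eq t d.
have : (t %% d < d)%N by rewrite ltn_mod.
by move: (t %/ d)%N (t %% d)%N r0 => q r r0 lt_r t_eq; lia.
Qed.

Definition facet_ratio (n : nat) (j : 'I_n) : rat :=
  (n - j)%:R / (n - j).+1`!%:R.

Lemma bnum_ratio n (j : 'I_n) :
  (bnum n.+1 j.+1)%:R = facet_ratio j * n.+1`!%:R :> rat.
Proof.
have f_neq0 : (n - j).+1`!%:R != 0 :> rat by rewrite pnatr_eq0 -lt0n fact_gt0.
rewrite /facet_ratio mulrAC -natrM -bnum_fact // natrM mulfK //.
Qed.

Lemma sum_facet_ratio n :
  \sum_(j < n) facet_ratio j * n.+1`!%:R = n.+1`!%:R - 1 :> rat.
Proof.
apply: (canRL (addrK _)).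
under eq_bigr do rewrite -bnum_ratio.
rewrite -natr_sum -[1]/(1%:R) -natrD sum_bnum //.
by rewrite -(ffact_fact (leqnSn n)) subSnn muln1.
Qed.

Lemma factoradic_coord n (lam : 'I_n.+1 -> rat) (j : 'I_n) :
  \sum_(i < n.+1) lam i * (factoradic_vertex n i j)%:~R =
  lam (lift ord0 j) - lam ord0 * (facet_ratio j * n.+1`!%:R).
Proof.
rewrite big_ord_recl (bigD1 j) //= big1 => [|i /negbTE ij].
  rewrite /factoradic_vertex /= /bump /= add1n eqxx mulr1 addr0 -bnum_ratio.
  by rewrite rmorphN /= mulrN addrC.
rewrite /factoradic_vertex /= /bump /= add1n eqSS.
by rewrite [(j : nat) == i]eq_sym [(i : nat) == j]ij mulr0.
Qed.

Lemma in_open_par_factoradicP n (y : 'I_n -> int) (h : int) : (0 < n)%N ->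
  in_open_par (factoradic_vertex n) y h <->
  exists b : nat, [/\ (b < n.+1`!)%N, interior_index n b,
    forall j, y j = - (facet_floor b j)%:Z & h = (digit_asc n b)%:Z].
Proof.
move=> n_gt0; pose Q : rat := n.+1`!%:R.
have Q_gt0 : 0 < Q by rewrite ltr0n fact_gt0.
have Q_neq0 : Q != 0 by rewrite gt_eqF.
have sumQ : \sum_(j < n) facet_ratio j * Q = Q - 1 := sum_facet_ratio n.
split=> [[lam [lam01 [lam_y lam_h]]]|[b [lt_b int_b y_b h_b]]].
  have lamS j : lam (lift ord0 j) = (y j)%:~R + lam ord0 * (facet_ratio j * Q).
    by rewrite lam_y factoradic_coord subrK.
  (* The weights of the unit vertices cancel, and the coordinates of vertex 0 leave [lam ord0] times
     (n+1)!. This integer is the index [b]. *)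
  have h_eq : (h - \sum_(j < n) y j)%:~R = lam ord0 * Q.
    rewrite rmorphB rmorph_sum /= lam_h big_ord_recl /=.
    under eq_bigr do rewrite lamS.
    rewrite big_split /= -mulr_sumr sumQ; ring.
  have b_gt0 : 0 < h - \sum_(j < n) y j.
    by rewrite -(ltr_int rat) h_eq mulr_gt0 //; case/andP: (lam01 ord0).
  have lt_b : h - \sum_(j < n) y j < n.+1`!%:Z.
    rewrite -(ltr_int rat) h_eq -[ltRHS]/Q -[ltRHS]mul1r ltr_pM2r //.
    by case/andP: (lam01 ord0).
  have [b b_eq] : exists b : nat, h - \sum_(j < n) y j = b%:Z.
    by exists (absz (h - \sum_(j < n) y j)%R); rewrite gez0_abs // ltW.
  rewrite b_eq in b_gt0 lt_b h_eq.
  have y_floor j : y j = - (facet_floor b j)%:Z /\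
                   ~~ ((n - j).+1`! %| b * (n - j))%N.
    apply: floor_unique.
    have d_gt0 : 0 < (n - j).+1`!%:R :> rat by rewrite ltr0n fact_gt0.
    have E : (y j * (n - j).+1`!%:Z + (b * (n - j))%N%:Z)%:~R
             = lam (lift ord0 j) * (n - j).+1`!%:R.
      by rewrite intr_scaled_frac ?fact_gt0 // lamS [_ * (_ * Q)]mulrCA -h_eq -pmulrn
                 [_ * b%:R]mulrC.
    rewrite -!(ltr_int rat) E.
    by case/andP: (lam01 (lift ord0 j)) => l0 l1; rewrite mulr_gt0 //= gtr_pMl.
  exists b; split=> //.
  - apply/forallP => j; have [_] := y_floor (rev_ord j) => /=.
    by have -> : (n - (n - j.+1) = j.+1)%N by have := ltn_ord j; lia.
  - by move=> j; have [] := y_floor j.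
  have lt_b' : (b < n.+1`!)%N by [].
  have : h = b%:Z + \sum_(j < n) y j by rewrite -b_eq subrK.
  under eq_bigr do rewrite (proj1 (y_floor _)).
  rewrite sumrN => ->; rewrite -{1}(sum_facet_floor lt_b').
  rewrite PoszD.
  have -> : (\sum_(j < n) facet_floor b j)%N%:Z = \sum_(j < n) (facet_floor b j)%:Z.
    exact: (big_morph Posz PoszD).
  by rewrite addrAC subrr add0r.
have b_gt0 : (0 < b)%N.
  rewrite lt0n; apply: contraTneq int_b => ->; apply/forallPn.
  by exists (Ordinal n_gt0); rewrite negbK mul0n dvdn0.
pose l (j : 'I_n) : rat := (y j)%:~R + b%:R * facet_ratio j.
(* The weights are [b / Q] at vertex 0 and the fractional parts of [b%:R * facet_ratio j] at the
   unit vertices. *)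
exists (fun i => if unlift ord0 i is Some j then l j else b%:R / Q); split.
  move=> i; case: unliftP => [j|] _; last first.
    apply/andP; split; first by rewrite divr_gt0 // ltr0n.
    by rewrite ltr_pdivrMr // mul1r ltr_nat.
  have d_gt0 : 0 < (n - j).+1`!%:R :> rat by rewrite ltr0n fact_gt0.
  have E := intr_scaled_frac (y j) b (n - j) (fact_gt0 (n - j).+1).
  have := floor_bounds (fact_gt0 _) (interior_index_rev int_b j).
  rewrite -[X in - X](_ : (facet_floor b j)%:Z = _) // -y_b -!(ltr_int rat) E.
  by rewrite pmulr_lgt0 // gtr_pMl.
split=> [j|].
  by rewrite factoradic_coord liftK unlift_none /l; field.
rewrite big_ord_recl unlift_none.
under eq_bigr do rewrite liftK.
rewrite /l big_split /= -mulr_sumr h_b.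
have E : \sum_(j < n) (y j)%:~R + b%:R = (digit_asc n b)%:~R :> rat.
  under eq_bigr do rewrite y_b.
  rewrite -{2}(sum_facet_floor lt_b) natrD natr_sum.
  under eq_bigr do rewrite rmorphN /=.
  by rewrite sumrN; ring.
rewrite -E; move: sumQ; rewrite -mulr_suml => /(canRL (mulfK Q_neq0)) ->.
by field.
Qed.

(** As [b] is below (n+1)!, the floor is at most [bnum n.+1 j.+1], the absolute value of a
    coordinate of vertex 0. *)
Lemma facet_floor_le_box n b (j : 'I_n) : (b < n.+1`!)%N ->
  (facet_floor b j <= box_bound (factoradic_vertex n))%N.
Proof.
move=> lt_b; apply: (@leq_trans (bnum n.+1 j.+1)).
  rewrite -[leqRHS](mulnK _ (fact_gt0 (n - j).+1)) bnum_fact //.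
  by rewrite leq_div2r // mulnC leq_mul2l ltnW ?orbT.
rewrite /box_bound (bigD1 ord0) //= (bigD1 j) //= -addnA.
by rewrite {1}/factoradic_vertex /= abszN leq_addr.
Qed.

Lemma lstar_factoradic n : (0 < n)%N -> lstar (factoradic_vertex n) = ascent_poly n.
Proof.
move=> n_gt0; rewrite /lstar /ascent_poly pair_big /=.
set M := box_bound _.
pose T := ({ffun 'I_n -> 'I_(2 * M).+1} * 'I_n.+2)%type.
pose y (u : T) (j : 'I_n) : int := (u.1 j)%:Z - M%:Z.
pose P (u : T) : bool :=
  if excluded_middle_informative (in_open_par (factoradic_vertex n) (y u) (u.2)%:Z)
  then true else false.
have PP u : reflect (in_open_par (factoradic_vertex n) (y u) (u.2)%:Z) (P u).
  by rewrite /P; case: excluded_middle_informative => ?; constructor.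
transitivity (\sum_(u : T | P u) ('X^(u.2) : {poly int})).
  rewrite [RHS]big_mkcond; apply: eq_bigr => u _.
  by rewrite /P; case: excluded_middle_informative.
(* The box stores coordinates shifted by [M]; [facet_floor_le_box] and [digit_asc_le] keep each
   [inord] in range. *)
pose f (b : 'I_(n.+1`!)) : T :=
  ([ffun j => inord (M - facet_floor b j)], inord (digit_asc n b)).
(* The index is recovered as height minus coordinate sum; points of the parallelepiped never reach
   the default of [insubd]. *)
pose g (u : T) : 'I_(n.+1`!) :=
  insubd (Ordinal (fact_gt0 n.+1)) (absz ((u.2)%:Z - \sum_(j < n) y u j)%R).
have yf b j : y (f b) j = - (facet_floor b j)%:Z.
  have := facet_floor_le_box j (ltn_ord b); rewrite -/M => le_M.
  by rewrite /y ffunE inordK; lia.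
have f2 b : (f b).2 = digit_asc n b :> nat.
  by rewrite /f inordK // !ltnS (leq_trans (digit_asc_le _ _)).
have abs_eq b : (b < n.+1`!)%N ->
    absz ((digit_asc n b)%:Z - \sum_(j < n) - (facet_floor b j)%:Z)%R = b.
  move=> lt_b; rewrite sumrN opprK.
  have -> : \sum_(j < n) (facet_floor b j)%:Z = (\sum_(j < n) facet_floor b j)%N%:Z.
    by rewrite (big_morph Posz PoszD (erefl _)).
  by rewrite -PoszD absz_nat addnC sum_facet_floor.
have gP u (b : nat) : (b < n.+1`!)%N -> (forall j, y u j = - (facet_floor b j)%:Z) ->
    (u.2)%:Z = (digit_asc n b)%:Z -> g u = b :> nat.
  move=> lt_b y_b h_b; rewrite /g h_b.
  under eq_bigr do rewrite y_b.
  by rewrite abs_eq // val_insubd lt_b.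
rewrite (reindex_onto f g) => [|u /PP /(in_open_par_factoradicP _ _ n_gt0)]; last first.
  case=> b [lt_b int_b y_b h_b]; have gu := gP u b lt_b y_b h_b.
  case: u y_b h_b gu => k h y_b h_b gu; congr pair.
    apply/ffunP => j; rewrite ffunE; apply: val_inj.
    by have := y_b j; rewrite /y /= gu => kj; rewrite inordK; lia.
  have hb : h = digit_asc n b :> nat by case: h_b.
  by apply: val_inj; rewrite /= gu -hb inordK.
have gf b : g (f b) = b :> nat.
  exact: gP (ltn_ord b) (yf b) (congr1 Posz (f2 b)).
rewrite big_mkord; apply: eq_big => [b|b _]; last by rewrite f2.
have -> : g (f b) == b by apply/eqP/val_inj/gf.
rewrite andbT; apply/PP/idP => [/(in_open_par_factoradicP _ _ n_gt0)|int_b].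
  case=> b' [lt_b' int_b' y_b' h_b'].
  suff <- : b' = b by [].
  by rewrite -(gP (f b) b' lt_b' y_b' h_b') gf.
apply/(in_open_par_factoradicP _ _ n_gt0); exists b.
by split; rewrite ?f2.
Qed.

Theorem theorem3p4 (n : nat) :
  (1 <= n)%N ->
  real_rooted (lstar (factoradic_vertex n)) /\
  unimodal (lstar (factoradic_vertex n)).
Proof.
move=> n_gt0; rewrite lstar_factoradic //.
by split; [exact: ascent_poly_real_rooted | exact: ascent_poly_unimodal].
Qed.
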